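(* Let $\theta_1<\cdots<\theta_{N-1}$ be thresholds in $I$ and let $C_1,\ldots,C_N$ be the partition of $I$ given by $C_1=\{z\in I:z\le\theta_1\}$, $C_i=(\theta_{i-1},\theta_i]$ for $1<i<N$, and $C_N=\{z\in I:z>\theta_{N-1}\}$. Suppose that $G\in\mathcal{P}$, and that $\theta_i\in\mathcal{D}(G)$, $G^{-1}(G(\theta_i))=\theta_i$ and $w_i>0$ whenever $1\le i\le N-1$. Define the scoring function $S_5:I\times I\to[0,\infty)$ by $$S_5(x,y)=\sum_{i=1}^{N-1}w_i\,S_{G(\theta_i),\theta_i}(x,y),\qquad x,y\in I.$$ Then $S_5$ is equal to $\mathrm{GDS}_{\mathrm d}(\cdot,\cdot\,;G,\mu)$ when $\mu=\sum_{i=1}^{N-1}w_i\delta_{G(\theta_i)}$, is equitable with respect to $G$ and has equitability constant $$\sum_{i=1}^{N-1}w_iG(\theta_i)(1-G(\theta_i)).$$ Moreover, if $x,x'\in C_j$ and $y,y'\in C_k$ then $S_5(x,y)=S_5(x',y')$.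
   Context: Let $I\subseteq\mathbb{R}$ be an interval. $\mathcal{P}$ is the class of Borel probability measures on $\mathbb{R}$ with mass concentrated in $I$, each identified with its right-continuous CDF. $\mathbf{1}$ denotes the indicator function and $\delta_a$ the unit point mass at $a$. $\mathcal{D}(G)=\{z\in\mathbb{R}:0<G(z)<1\}$; $\mathcal{R}(G)=\{\alpha\in(0,1):G(z)=\alpha\text{ for some }z\in\mathbb{R}\}$; $G^{-1}(\alpha)=\min\{z\in\mathbb{R}:G(z)\ge\alpha\}$ for $\alpha\in(0,1)$. For $\alpha\in(0,1)$, $\theta\in I$ and $x,y\in I$, $S_{\alpha,\theta}(x,y)=(\mathbf{1}\{y<x\}-\alpha)(\mathbf{1}\{\theta<x\}-\mathbf{1}\{\theta<y\})$, i.e. $\alpha$ if $x\le\theta<y$, $1-\alpha$ if $x>\theta\ge y$, and $0$ otherwise. For a Borel measure $\mu$ on $(0,1)$, $$\mathrm{GDS}_{\mathrm d}(x,y;G,\mu)=\int_{\mathcal{R}(G)}S_{\alpha,G^{-1}(\alpha)}(x,y)\,\mathrm{d}\mu(\alpha).$$ A scoring function $S:\mathcal{F}\times\mathcal{O}\to[-\infty,\infty]$ is equitable with respect to a distribution $G$ on $\mathcal{O}$ if there is $c\in\mathbb{R}$ (the equitability constant) with $\mathbb{E}_G S(x,Y)=c$ for every $x\in\mathcal{F}$, where $Y$ has distribution $G$. *)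

(* Defs.v *)
From HB Require Import structures.
From mathcomp Require Import all_boot all_order all_algebra.
From mathcomp Require Import all_classical all_reals all_analysis.

Set Implicit Arguments.
Unset Strict Implicit.
Unset Printing Implicit Defensive.

Import Order.TTheory GRing.Theory Num.Theory.
Import numFieldNormedType.Exports.

Local Open Scope classical_set_scope.
Local Open Scope ring_scope.

(* The class P of Borel probability measures on the line concentrated on I. *)
Definition concentrated_on (R : realType) (I : interval R)
  (G : probability (measurableTypeR R) R) : Prop := G [set` I] = 1%E.

Definition idRV (R : realType) : measurableTypeR R -> R := idfun.

HB.instance Definition _ (R : realType) :=
  @isMeasurableFun.Build _ _ (measurableTypeR R) R (@idRV R)
    (@measurable_id _ _ setT).

(* The CDF of G itself, i.e. z |-> G(]-oo, z]), with values in R. *)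
Definition CDF (R : realType) (G : probability (measurableTypeR R) R) (z : R)
  : R := fine (cdf (@idRV R : {RV G >-> R}) z).

(* The set D(G). *)
Definition cdf_dom (R : realType) (G : probability (measurableTypeR R) R)
  : set R := [set z | 0 < CDF G z < 1].

(* The set R(G). *)
Definition cdf_range (R : realType) (G : probability (measurableTypeR R) R)
  : set R := [set a | 0 < a < 1 /\ exists z, CDF G z = a].

(* G^{-1}(a), the least element of {z | G(z) >= a}. It exists when 0 < a < 1;
   the default value 0 can only be returned for other a. *)
Definition quantile (R : realType) (G : probability (measurableTypeR R) R)
  (a : R) : R :=
  let A := [set z | a <= CDF G z] in xget 0 (A `&` lbound A).

Definition elementary_score (R : realType) (a theta x y : R) : R :=
  ((y < x)%R%:R - a) * ((theta < x)%R%:R - (theta < y)%R%:R).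

(* GDS_d(x, y; G, mu). A Borel measure on ]0, 1[ is represented by a Borel
   measure on the line; only its restriction to ]0, 1[ matters because
   cdf_range G is included in ]0, 1[. *)
Definition GDSd (R : realType) (G : probability (measurableTypeR R) R)
  (mu : {measure set (measurableTypeR R) -> \bar R}) (x y : R) : \bar R :=
  (\int[mu]_(a in cdf_range G) (elementary_score a (quantile G a) x y)%:E)%E.

Section dirac_comb.
Context (R : realType) (n : nat) (w : 'I_n -> {nonneg R}) (a : 'I_n -> R).
Local Open Scope ereal_scope.

(* The measure \sum_i w_i delta_{a_i}. *)
Definition dirac_comb (A : set (measurableTypeR R)) : \bar R :=
  \sum_(i < n) (w i)%:num%:E * \d_(a i) A.

Let dirac_comb0 : dirac_comb set0 = 0.
Proof. by rewrite /dirac_comb big1// => i _; rewrite measure0 mule0. Qed.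

Let dirac_comb_ge0 A : 0 <= dirac_comb A.
Proof. by apply: sume_ge0 => i _; exact: mule_ge0. Qed.

Let dirac_comb_sigma_additive : semi_sigma_additive dirac_comb.
Proof.
move=> F mF tF mUF; rewrite [X in _ --> X](_ : _ =
    lim ((fun n => \sum_(0 <= i < n) dirac_comb (F i)) @ \oo)).
  by apply: is_cvg_ereal_nneg_natsum => k _; exact: dirac_comb_ge0.
rewrite nneseries_sum; last by move=> *; exact: mule_ge0.
by apply: eq_bigr => /= i _; exact: (measure_semi_bigcup (mscale (w i) \d_(a i))).
Qed.

HB.instance Definition _ := isMeasure.Build _ _ _ dirac_comb
  dirac_comb0 dirac_comb_ge0 dirac_comb_sigma_additive.

End dirac_comb.

(* E_G S(x, Y) = c for every forecast x in F, where Y ~ G takes values in O.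
   The library's integral is total, so the existence of a finite expectation is
   asserted through integrability. *)
Definition equitability_constant (R : realType) (T1 : Type)
  (d : measure_display) (T2 : measurableType d) (F : set T1) (O : set T2)
  (S : T1 -> T2 -> \bar R) (G : probability T2 R) (c : R) : Prop :=
  forall x, F x ->
    G.-integrable O (S x) /\ (\int[G]_(y in O) S x y)%E = c%:E.

Definition equitable (R : realType) (T1 : Type)
  (d : measure_display) (T2 : measurableType d) (F : set T1) (O : set T2)
  (S : T1 -> T2 -> \bar R) (G : probability T2 R) : Prop :=
  exists c : R, equitability_constant F O S G c.

(* With n = N - 1 thresholds numbered from 0, the category number j (from 0) is
   bounded below by the threshold j - 1, if any, and above by the threshold j,
   if any. *)
Definition category (R : realType) (I : interval R) (n : nat)
  (theta : 'I_n -> R) (j : 'I_n.+1) : set R :=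
  [set z | z \in I /\
     forall i : 'I_n, (i.+1 = j :> nat -> theta i < z) /\
                      (i = j :> nat -> z <= theta i)].

Definition S5 (R : realType) (G : probability (measurableTypeR R) R) (n : nat)
  (theta w : 'I_n -> R) (x y : R) : R :=
  \sum_(i < n) w i * elementary_score (CDF G (theta i)) (theta i) x y.

(* Main.v *)
Require Import Defs.
From HB Require Import structures.
From mathcomp Require Import all_boot all_order all_algebra.
From mathcomp Require Import all_classical all_reals all_analysis.
From mathcomp Require Import measurable_realfun.

Set Implicit Arguments.
Unset Strict Implicit.
Unset Printing Implicit Defensive.

Import Order.TTheory GRing.Theory Num.Theory.
Import numFieldNormedType.Exports.

(** Fix a threshold [theta] and [a = CDF G theta]. As a function of [y], the
    elementary score is [1 - a] times the indicator of [y <= theta] if the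
    forecast [x] exceeds [theta], and [a] times the indicator of [theta < y]
    otherwise ([elementary_scoreE]). Under [G] these two events have
    probabilities [a] and [1 - a], so the expected score is [a * (1 - a)] for
    every forecast; weighting and summing over the thresholds gives
    equitability of [S5] and its constant ([S5_equitability]).

    The same formula shows that an elementary score depends on [x] and [y] only
    through the side of [theta] on which each of them lies, and inside a
    category these sides are the same for all points ([category_threshold]).

    For the representation as an integral, the quantile of [CDF G (theta i)] is
    [theta i], so it remains to integrate against a finite sum of weighted point
    masses ([ge0_integral_dirac_comb]). That lemma makes no measurability
    assumption on the nonnegative integrand or on the domain, so neither the
    quantile function nor the range of the CDF has to be shown to be Borel. *)

Local Open Scope classical_set_scope.
Local Open Scope ring_scope.

(** The factor [y < x] of the definition matters only when [theta] separates [x]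
    from [y], and then it is determined by the side on which [x] lies. *)
Lemma elementary_scoreE (R : realType) (a theta x y : R) :
  elementary_score a theta x y =
  if theta < x then (1 - a) * (y <= theta)%R%:R else a * (theta < y)%R%:R.
Proof.
rewrite /elementary_score.
case: (ltP theta x) => [tx|xt]; case: (leP y theta) => yt /=.
- by rewrite (le_lt_trans yt tx) subr0.
- by rewrite subrr !mulr0.
- by rewrite subrr !mulr0.
- by rewrite ltNge (ltW (le_lt_trans xt yt)) /= !sub0r mulrN1 opprK mulr1.
Qed.

Lemma elementary_score_ge0 (R : realType) (a theta x y : R) :
  0 <= a <= 1 -> 0 <= elementary_score a theta x y.
Proof.
case/andP=> a0 a1; rewrite elementary_scoreE.
by case: ifP => _; rewrite mulr_ge0 ?ler0n ?subr_ge0.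
Qed.

Section integral_dirac_comb.
Import HBNNSimple.
Local Open Scope ereal_scope.
Context (R : realType) (n : nat) (w : 'I_n -> {nonneg R}) (a : 'I_n -> R).

(** The [k]-th weighted point mass, indexed by all natural numbers (and null
    from [n] on) as required by [msum]. *)
Let component (k : nat) : {measure set (measurableTypeR R) -> \bar R} :=
  if insub k is Some i
  then mscale (w i) (@dirac _ (measurableTypeR R) (a i) R) else mzero.

Lemma ge0_measurable_integral_dirac_comb (f : measurableTypeR R -> \bar R) :
  measurable_fun [set: measurableTypeR R] f -> (forall x, 0 <= f x) ->
  \int[dirac_comb w a]_x f x = \sum_(i < n) (w i)%:num%:E * f (a i).
Proof.
move=> mf f0; rewrite (eq_measure_integral (msum component n)); last first.
  move=> A mA _; rewrite /= /dirac_comb /msum; apply: eq_bigr => i _.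
  by rewrite /component valK.
rewrite ge0_integral_measure_sum//; apply: eq_bigr => i _.
rewrite /component valK ge0_integral_mscale//.
by rewrite integral_dirac// diracT mul1e.
Qed.

(** A nonnegative function, measurable or not, is integrated by a finite sum of
    point masses to the weighted sum of its values: its integral is the supremum
    of the integrals of the simple functions below it, and it dominates its own
    restriction to the finite set of atoms, which is measurable and already has
    the right integral. *)
Lemma ge0_integral_dirac_comb (D : set (measurableTypeR R))
    (f : measurableTypeR R -> \bar R) :
  (forall i, D (a i)) -> (forall x, D x -> 0 <= f x) ->
  \int[dirac_comb w a]_(x in D) f x = \sum_(i < n) (w i)%:num%:E * f (a i).
Proof.
move=> Da f0; rewrite integral_mkcond; set g := f \_ D.
have g0 x : 0 <= g x by exact: erestrict_ge0.
have ga i : g (a i) = f (a i) by rewrite /g patchE mem_set.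
under [RHS]eq_bigr do rewrite -ga.
apply/eqP; rewrite eq_le; apply/andP; split.
  rewrite ge0_integralTE//; apply: ub_ereal_sup => _ [h hg <-].
  rewrite -integralT_nnsfun ge0_measurable_integral_dirac_comb//.
  - by apply: lee_sum => i _; exact: lee_wpmul2l.
  - by apply/measurable_EFinP; exact: measurable_funPT.
  - by move=> x; rewrite lee_fin.
pose A : set (measurableTypeR R) := range a.
have mset1 (x : measurableTypeR R) : measurable [set x].
  exact: measurable_set1.
have countA (B : set (measurableTypeR R)) : B `<=` A -> measurable B.
  move=> BA; apply: countable_measurable => //.
  apply: finite_set_countable; apply: sub_finite_set BA _.
  exact: finite_image.
have mA : measurable A by exact: countA.
have mgA : measurable_fun [set: measurableTypeR R] (g \_ A).
  apply/(measurable_restrictT _ mA).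
  by move=> _ B mB; apply: countA; exact: subIsetl.
rewrite [leLHS](_ : _ = \int[dirac_comb w a]_x (g \_ A) x); last first.
  rewrite ge0_measurable_integral_dirac_comb//.
    by apply: eq_bigr => i _; rewrite patchE mem_set//; exists i.
  by move=> x; exact: erestrict_ge0.
(* For nonnegative functions the integral is monotone without measurability. *)
rewrite !ge0_integralTE//; last by move=> x; exact: erestrict_ge0.
apply: ereal_sup_le => _ [h hg <-].
exists h => // x; apply: le_trans (hg x) _.
by rewrite patchE; case: ifP.
Qed.

End integral_dirac_comb.

Lemma CDFE (R : realType) (G : probability (measurableTypeR R) R) (z : R) :
  (CDF G z)%:E = G [set` `]-oo, z]].
Proof. by rewrite /CDF fineK ?fin_num_measure. Qed.

Lemma concentrated_onI (R : realType) (I : interval R)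
    (G : probability (measurableTypeR R) R) (A : set (measurableTypeR R)) :
  concentrated_on I G -> measurable A -> G (A `&` [set` I]) = G A.
Proof.
move=> GI mA; have mI : measurable ([set` I] : set (measurableTypeR R)).
  exact: measurable_itv.
have GIC0 : G (~` [set` I]) = 0%E.
  by rewrite probability_setC// [X in (1 - X)%E]GI subee.
rewrite [RHS](measureDI _ mA mI) [X in (X + _)%E](_ : _ = 0%E) ?add0e//.
apply: (subset_measure0 (B := ~` [set` I] : set (measurableTypeR R))).
- exact: measurableD.
- exact: measurableC.
- by move=> y [].
- exact: GIC0.
Qed.

(** The set [F] of forecasts is arbitrary: the expected score is the same for
    every real forecast. *)
Lemma elementary_score_equitability (R : realType) (I : interval R)
    (G : probability (measurableTypeR R) R) (F : set R) (theta : R) :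
  concentrated_on I G ->
  equitability_constant F ([set` I] : set (measurableTypeR R))
    (fun x y => (elementary_score (CDF G theta) theta x y)%:E) G
    (CDF G theta * (1 - CDF G theta)).
Proof.
move=> GI x Fx; set c := CDF G theta.
have mI : measurable ([set` I] : set (measurableTypeR R)).
  exact: measurable_itv.
have ind (k : R) (A : set (measurableTypeR R)) : measurable A ->
    G.-integrable ([set` I] : set (measurableTypeR R))
      (fun y => (k * \1_A y)%:E) /\
    (\int[G]_(y in [set` I]) (k * \1_A y)%:E = k%:E * G A)%E.
  move=> mA; have iA : G.-integrable ([set` I] : set (measurableTypeR R))
      (fun y => (\1_A y)%:E).
    by apply: integrableS (integrable_indic _ mA).
  split; first exact: (integrableZl mI k iA).
  under eq_integral do rewrite EFinM.
  by rewrite integralZl// integral_indic//; congr (_ * _)%E;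
    exact: concentrated_onI.
have [tx|xt] := ltP theta x.
- have := ind (1 - c) [set` `]-oo, theta]] (measurable_itv _).
  rewrite (_ : (fun y => _) =
    (fun y => (elementary_score c theta x y)%:E)); last first.
    apply/funext => y; rewrite elementary_scoreE tx indicE.
    by congr (_ * _%:R)%:E; rewrite mem_setE in_itv.
  by rewrite -CDFE -EFinM mulrC.
- have := ind c (~` [set` `]-oo, theta]]) (measurableC (measurable_itv _)).
  rewrite (_ : (fun y => _) =
    (fun y => (elementary_score c theta x y)%:E)); last first.
    apply/funext => y; rewrite elementary_scoreE ltNge xt /= indicE.
    by congr (_ * _%:R)%:E; rewrite in_setC mem_setE in_itv/= -ltNge.
  by rewrite probability_setC// -CDFE -EFinB -EFinM.
Qed.

Lemma S5_equitability (R : realType) (I : interval R) (n : nat)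
    (theta w : 'I_n -> R) (G : probability (measurableTypeR R) R) (F : set R) :
  concentrated_on I G ->
  equitability_constant F ([set` I] : set (measurableTypeR R))
    (fun x y => (S5 G theta w x y)%:E) G
    (\sum_(i < n) w i * CDF G (theta i) * (1 - CDF G (theta i))).
Proof.
move=> GI x Fx; have mI : measurable ([set` I] : set (measurableTypeR R)).
  exact: measurable_itv.
have ES i := elementary_score_equitability (theta i) GI Fx.
rewrite (_ : (fun y => _) = (fun y => \sum_(i < n)
    (w i * elementary_score (CDF G (theta i)) (theta i) x y)%:E)%E); last first.
  by apply/funext => y; rewrite sumEFin.
have iE i : G.-integrable ([set` I] : set (measurableTypeR R))
    (fun y => (w i * elementary_score (CDF G (theta i)) (theta i) x y)%:E).
  by case: (ES i) => iES _; exact: (integrableZl mI (w i) iES).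
split; first by apply: integrable_sum.
rewrite integral_sum// -sumEFin; apply: eq_bigr => i _.
under eq_integral do rewrite EFinM.
by case: (ES i) => ? E; rewrite integralZl// E -EFinM mulrA.
Qed.

(** The points of category [j] exceed exactly the first [j] thresholds. *)
Lemma category_threshold (R : realType) (I : interval R) (n : nat)
    (theta : 'I_n -> R) (j : 'I_n.+1) (z : R) (i : 'I_n) :
  (forall i j : 'I_n, (i < j)%N -> theta i < theta j) ->
  category I theta j z -> (theta i < z) = (i < j)%N.
Proof.
move=> theta_incr [_ zj].
have theta_le (k l : 'I_n) : (k <= l)%N -> theta k <= theta l.
  rewrite leq_eqVlt => /predU1P[/val_inj-> //|kl].
  exact/ltW/theta_incr.
apply/idP/idP => [|ij].
  apply: contraTT; rewrite -!leNgt -leqNgt => ji.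
  have jn : (j < n)%N by exact: leq_ltn_trans ji (ltn_ord i).
  have [_ /(_ erefl) zt] := zj (Ordinal jn).
  exact: le_trans zt (theta_le (Ordinal jn) i ji).
have j0 : (0 < j)%N by exact: leq_ltn_trans ij.
have jn : (j.-1 < n)%N by rewrite prednK// -ltnS.
have [/(_ (prednK j0)) tz _] := zj (Ordinal jn).
apply: le_lt_trans tz; apply: theta_le => /=.
by rewrite -ltnS prednK.
Qed.

Theorem proposition7 (R : realType) (I : interval R) (n : nat)
  (theta w : 'I_n -> R) (G : probability (measurableTypeR R) R)
  (theta_incr : forall i j : 'I_n, (i < j)%N -> theta i < theta j)
  (theta_I : forall i, theta i \in I)
  (G_I : concentrated_on I G)
  (theta_D : forall i, cdf_dom G (theta i))
  (theta_quantile : forall i, quantile G (CDF G (theta i)) = theta i)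
  (w_gt0 : forall i, 0 < w i) :
  let S := S5 G theta w in
  let mu := dirac_comb (fun i => NngNum (ltW (w_gt0 i)))
                       (fun i => CDF G (theta i)) in
  let ES := (fun x y => (S x y)%:E) in
  [/\ forall x y, x \in I -> y \in I -> 0 <= S x y,
      forall x y, x \in I -> y \in I -> (S x y)%:E = GDSd G mu x y,
      equitable [set` I] ([set` I] : set (measurableTypeR R)) ES G,
      equitability_constant [set` I] ([set` I] : set (measurableTypeR R)) ES G
        (\sum_(i < n) w i * CDF G (theta i) * (1 - CDF G (theta i)))
    & forall (j k : 'I_n.+1) (x x' y y' : R),
        category I theta j x -> category I theta j x' ->
        category I theta k y -> category I theta k y' ->
        S x y = S x' y'].
Proof.
move=> S mu ES.
have cdf01 i : 0 < CDF G (theta i) < 1 := theta_D i.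
have equi := S5_equitability theta w (F := [set` I]) G_I.
split.
- move=> x y _ _; apply: sumr_ge0 => i _; apply: mulr_ge0; first exact: ltW.
  by apply: elementary_score_ge0; case/andP: (cdf01 i) => /ltW -> /ltW.
- move=> x y _ _; rewrite /GDSd ge0_integral_dirac_comb.
  + rewrite -sumEFin; apply: eq_bigr => i _.
    by rewrite theta_quantile EFinM.
  + by move=> i; split => //; exists (theta i).
  + move=> a [/andP[a0 a1] _]; rewrite lee_fin.
    by apply: elementary_score_ge0; rewrite !ltW.
- by eexists; exact: equi.
- exact: equi.
- move=> j k x x' y y' jx jx' ky ky'; apply: eq_bigr => i _.
  have thr := category_threshold i theta_incr.
  by rewrite !elementary_scoreE !leNgt (thr _ _ _ jx) (thr _ _ _ jx')
    (thr _ _ _ ky) (thr _ _ _ ky').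
Qed.
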